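(* Let $M$ and $L$ be positive integers. Then $$A_{ML}(t)=A_M(t)\,A_L(t^M)$$ plethystically, and $$\mathscr{T}_{ML}(t)=\mathscr{T}_L(t^M)\,\mathscr{T}_M(t).$$ Consequently, for every $N\ge0$, $$C_N^{[ML]}(t)=C_N^{[M]}(t)\,C_N^{[L]}(t^M)=C_N^{[L]}(t^M)\,C_N^{[M]}(t).$$
   Context: For a positive integer $M$, $A_M(t)=1+t+\cdots+t^{M-1}$ is regarded as a finite plethystic alphabet, with $p_n[A_M(t)]=1+t^n+\cdots+t^{(M-1)n}$ and $p_n[AB]=p_n[A]p_n[B]$; a plethystic identity of alphabets means equality of $p_n$ of both sides for all $n\ge1$. $A_L(t^M)$ is $A_L$ with $t$ replaced by $t^M$. A strict partition is a finite sequence $\lambda=(\lambda_1>\cdots>\lambda_\ell>0)$ of integers, with $|\lambda|=\sum\lambda_i$, $\ell(\lambda)=\ell$; $\mathrm{SP}(N)$ is the set of strict partitions of $N$. Let $\Gamma=\mathbb{Q}[p_1,p_3,p_5,\ldots]$ be the ring of odd power sums, graded by $\deg p_n=n$, with degree-$N$ component $\Gamma_N$. The Schur $Q$-functions $Q_\lambda\in\Gamma$ are defined as follows: $q_r$ is given by $\sum_{r\ge0}q_rz^r=\exp\bigl(2\sum_{n\ge1,\ n\text{ odd}}\frac{p_n}{n}z^n\bigr)$; for $r\ge s\ge0$ let $Q_{(r,s)}=q_rq_s+2\sum_{k=1}^{s}(-1)^kq_{r+k}q_{s-k}$; in general $Q_\lambda$ is the Pfaffian of the antisymmetric matrix with entries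 $Q_{(\lambda_i,\lambda_j)}$ for $i<j$, where a zero part is appended to $\lambda$ if $\ell(\lambda)$ is odd (so $Q_{(r)}=q_r$, $Q_\varnothing=1$). $\{Q_\lambda:\lambda\in\mathrm{SP}(N)\}$ is a basis of $\Gamma_N$. $\mathscr{T}_M(t)$ is the plethystic operator $\mathscr{T}_M(t)f(X)=f[A_M(t)X]$ on $\Gamma$ with scalars extended to $\mathbb{Q}(t)$, i.e. the algebra map $p_n\mapsto(1+t^n+\cdots+t^{(M-1)n})p_n$ ($n$ odd); $\mathscr{T}_L(t^M)$ is obtained by replacing $t$ by $t^M$. The matrix $C_N^{[M]}(t)=(C^{[M]}_{\lambda\mu}(t))_{\lambda,\mu\in\mathrm{SP}(N)}$ (rows and columns in the same fixed order) is defined by $C^{[M]}_{\lambda\mu}(t):=C_{\lambda\mu}(t^M,t)$, where $C_{\lambda\mu}(t,s)$ is given by $T_{t,s}Q_\lambda=\sum_{\mu\in\mathrm{SP}(N)}C_{\lambda\mu}(t,s)Q_\mu$ and $T_{t,s}$ is the algebra automorphism with $T_{t,s}(p_n)=\frac{1-t^n}{1-s^n}p_n$ ($n$ odd); equivalently $\mathscr{T}_M(t)Q_\lambda=\sum_{\mu}C^{[M]}_{\lambda\mu}(t)Q_\mu$. *)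

(* Defs.v *)
From HB Require Import structures.
From mathcomp Require Import all_boot all_order all_algebra finmap.
From mathcomp.classical Require Import boolp classical_sets.
From mathcomp.multinomials Require Import monalg.

Set Implicit Arguments.
Unset Strict Implicit.
Unset Printing Implicit Defensive.

Import GRing.Theory.
Local Open Scope ring_scope.

(* A finite alphabet is the list of its letters. *)
Definition alphabet (K : fieldType) := seq K.

Definition pleth_p (K : fieldType) (n : nat) (A : alphabet K) : K :=
  \sum_(a <- A) a ^+ n.

Definition alph_mul (K : fieldType) (A B : alphabet K) : alphabet K :=
  [seq a * b | a <- A, b <- B].

Definition pleth_eq (K : fieldType) (A B : alphabet K) : Prop :=
  forall n : nat, (0 < n)%N -> pleth_p n A = pleth_p n B.

(* A_M(u) = 1 + u + ... + u^(M-1) *)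
Definition alphA (K : fieldType) (M : nat) (u : K) : alphabet K :=
  [seq u ^+ i | i <- iota 0 M].

Lemma pleth_pM (K : fieldType) n (A B : alphabet K) :
  pleth_p n (alph_mul A B) = pleth_p n A * pleth_p n B.
Proof.
rewrite /pleth_p /alph_mul big_allpairs_dep mulr_suml; apply: eq_bigr => a _.
by rewrite mulr_sumr; apply: eq_bigr => b _; rewrite exprMn.
Qed.

Lemma pleth_p_alphA (K : fieldType) n M (u : K) :
  pleth_p n (alphA M u) = \sum_(i < M) u ^+ (i * n).
Proof.
rewrite /pleth_p /alphA big_map -[M in LHS]subn0 -/(index_iota 0 M) big_mkord.
by apply: eq_bigr => i _; rewrite exprM.
Qed.

(* K (x) Gamma = K[p_1, p_3, p_5, ...]; the variable of index i is p_(2i+1). *)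
Definition Gamma (K : fieldType) : Type := {malg K[{cmonom nat}]}.
HB.instance Definition _ (K : fieldType) :=
  GRing.ComAlgebra.on (Gamma K).

(* Only meaningful for n odd. *)
Definition pvar (K : fieldType) (n : nat) : Gamma K :=
  mkmalgU (ucm n./2) (1 : K).
Arguments pvar : simpl never.

Definition mon_subst (K : fieldType) (x : nat -> Gamma K) (m : {cmonom nat}) :
    Gamma K :=
  \prod_(i <- finsupp m) x i ^+ m i.

Fact mon_subst_mmorphism (K : fieldType) (x : nat -> Gamma K) :
  mmorphism (mon_subst x).
Proof.
have monE (d : {fset nat}) (m : {cmonom nat}) : (finsupp m `<=` d)%fset ->
    mon_subst x m = \prod_(i <- d) x i ^+ m i.
  move=> le; rewrite /mon_subst (big_fset_incl _ le) // => i _.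
  by rewrite -cmE_neq0 negbK => /eqP ->.
split=> [m1 m2|]; last first.
  by rewrite /mon_subst mdom1 big_seq_fset0.
rewrite (monE (finsupp (mmul m1 m2)) m1) ?(monE (finsupp (mmul m1 m2)) m2);
  rewrite ?mdomD ?fsubsetUl ?fsubsetUr //.
rewrite /mon_subst mdomD -big_split /=.
by apply: eq_bigr => i _; rewrite cmM exprD.
Qed.

HB.instance Definition _ (K : fieldType) (x : nat -> Gamma K) :=
  isMultiplicative.Build {cmonom nat} (Gamma K) (mon_subst x)
    (mon_subst_mmorphism x).

(* The K-algebra endomorphism p_n |-> c n *: p_n (n odd). *)
Definition pscale (K : fieldType) (c : nat -> K) : Gamma K -> Gamma K :=
  mmap (GRing.in_alg (Gamma K))
       (mon_subst (fun i => c i.*2.+1 *: pvar K i.*2.+1)).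

HB.instance Definition _ (K : fieldType) (c : nat -> K) :=
  GRing.RMorphism.on (pscale c).

Lemma pscale_pvar (K : fieldType) (c : nat -> K) n :
  odd n -> pscale c (pvar K n) = c n *: pvar K n.
Proof.
move=> n_odd; rewrite /pscale [X in mmap _ _ X]/pvar mmapU /= scale1r mul1r.
rewrite /mon_subst mdomU big_seq_fset1 cmUU expr1.
by have -> : n./2.*2.+1 = n by rewrite -[RHS]odd_double_half n_odd.
Qed.

Lemma pscaleZ (K : fieldType) (c : nat -> K) (a : K) (f : Gamma K) :
  pscale c (a *: f) = a *: pscale c f.
Proof. by rewrite /pscale mmapZ -[RHS]mulr_algl. Qed.

(* f(X) |-> f[A X] *)
Definition pleth_mul (K : fieldType) (A : alphabet K) : Gamma K -> Gamma K :=
  pscale (fun n => pleth_p n A).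

Definition opT (K : fieldType) (M : nat) (u : K) : Gamma K -> Gamma K :=
  pleth_mul (alphA M u).

(* q_r is the coefficient of z^r in exp(G(z)), G(z) = 2 sum_(n odd) p_n/n z^n.
   Since G(0) = 0, only the terms n <= r of G and the terms G^k/k!, k <= r, of
   the exponential contribute. *)
Definition logq (K : fieldType) (r : nat) : {poly Gamma K} :=
  \poly_(n < r.+1) (if odd n then (2%:R / n%:R : K) *: pvar K n else 0).

Definition qfun (K : fieldType) (r : nat) : Gamma K :=
  \sum_(k < r.+1) (k`!%:R^-1 : K) *: (logq K r ^+ k)`_r.

Definition Q2 (K : fieldType) (r s : nat) : Gamma K :=
  qfun K r * qfun K s
  + (\sum_(1 <= k < s.+1) (-1) ^+ k * qfun K (r + k) * qfun K (s - k)) *+ 2.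

(* Pfaffian of an antisymmetric matrix, by expansion along the first row. *)
Fixpoint pfaffian (R : comNzRingType) (m : nat) : 'M[R]_(m.*2) -> R :=
  match m return 'M[R]_(m.*2) -> R with
  | 0 => fun _ => 1
  | m'.+1 => fun A : 'M[R]_(m'.*2.+2) =>
      \sum_(j < m'.*2.+1)
        (-1) ^+ j * A ord0 (lift ord0 j)
        * pfaffian (col' j (col' ord0 (row' j (row' ord0 A))))
  end.

(* [nth 0 la] supplies the zero part appended when [size la] is odd. *)
Definition Qmx (K : fieldType) (la : seq nat) :
    'M[Gamma K]_((uphalf (size la)).*2) :=
  \matrix_(i, j)
    if (i < j)%N then Q2 K (nth 0%N la i) (nth 0%N la j)
    else if (j < i)%N then - Q2 K (nth 0%N la j) (nth 0%N la i)
    else 0.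

Definition schurQ (K : fieldType) (la : seq nat) : Gamma K :=
  pfaffian (Qmx K la).

Definition is_strict_part (N : nat) (la : seq nat) : bool :=
  [&& sorted gtn la, all (leq 1) la & sumn la == N].

Record SP (N : nat) : predArgType :=
  StrictPart { parts :> seq nat; _ : is_strict_part N parts }.

HB.instance Definition _ (N : nat) := [isSub for @parts N].
HB.instance Definition _ (N : nat) := [Countable of SP N by <:].

Definition SP_enum (N : nat) : seq (SP N) :=
  undup (pmap insub
    [seq mask (m : N.-tuple bool) (rev (iota 1 N)) | m : N.-tuple bool]).

Fact SP_enumP (N : nat) : Finite.axiom (SP_enum N).
Proof.
move=> la; rewrite count_uniq_mem ?undup_uniq // mem_undup mem_pmap_sub.
have /and3P[la_dec la_pos /eqP la_sum] := valP la.
have le_sum x (s : seq nat) : x \in s -> (x <= sumn s)%N.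
  elim: s => //= y s IHs; rewrite inE => /predU1P[->|/IHs le_x].
    exact: leq_addr.
  exact: leq_trans le_x (leq_addl _ _).
set r := rev (iota 1 N).
have r_dec : sorted gtn r by rewrite rev_sorted iota_ltn_sorted.
have gtn_tr : transitive gtn by move=> y x z xy yz; exact: ltn_trans yz xy.
have defla : filter (mem (val la)) r = val la.
  apply: (@irr_sorted_eq _ gtn) => // [x||x]; first exact: ltnn.
  - exact: sorted_filter.
  rewrite mem_filter /= mem_rev mem_iota add1n ltnS.
  apply/andP/idP => [[]//|x_la]; rewrite x_la (allP la_pos) //.
  by rewrite -la_sum le_sum.
have sz : size (map (mem (val la)) r) == N by rewrite size_map size_rev size_iota.
suff -> : val la \in [seq mask (tval m) r | m : N.-tuple bool] by [].
apply/mapP; exists (Tuple sz); first by rewrite mem_enum.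
by rewrite -[LHS]defla filter_mask.
Qed.

HB.instance Definition _ (N : nat) := isFinite.Build (SP N) (@SP_enumP N).

(* The coefficient of Q_mu in the expansion of v in the basis (Q_mu). *)
Definition Qcoef (K : fieldType) (N : nat) (v : Gamma K) (mu : SP N) : K :=
  xget [ffun=> 0]
    (fun f : {ffun SP N -> K} =>
       v = \sum_(nu : SP N) f nu *: schurQ K nu) mu.

(* The value at x of the extension of the ring morphism phi to the fractions
   that have a representative whose denominator is not killed by phi. *)
Definition frac_eval (R : idomainType) (F : fieldType) (phi : R -> F)
    (x : {fraction R}) : F :=
  xget 0 (fun y : F => exists n d : R,
    [/\ phi d != 0, x = FracField.tofrac n / FracField.tofrac d
      & y = phi n / phi d]).

Notation Qt := {fraction {poly rat}}.
Definition tQ : Qt := FracField.tofrac 'X.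

(* Q(t,s): in {poly {poly rat}} the outer variable is t, the inner one is s. *)
Notation Qts := {fraction {poly {poly rat}}}.
Definition tQ2 : Qts := FracField.tofrac 'X.
Definition sQ2 : Qts := FracField.tofrac ('X)%:P.

Definition Tts : Gamma Qts -> Gamma Qts :=
  pscale (fun n => (1 - tQ2 ^+ n) / (1 - sQ2 ^+ n)).

Definition Cts (N : nat) (la mu : SP N) : Qts := Qcoef (Tts (schurQ Qts la)) mu.

(* r(t,s) |-> r(t^M,t): horner evaluation replaces t by X^M and leaves s = X,
   which is then renamed t. *)
Definition specialize_ts (M : nat) : Qts -> Qt :=
  frac_eval (fun p : {poly {poly rat}} => FracField.tofrac p.['X^M]).

(* r(t) |-> r(t^M) *)
Definition subst_pow (M : nat) : Qt -> Qt :=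
  frac_eval (fun p : {poly rat} => FracField.tofrac (p \Po 'X^M)).

(* Rows and columns follow the enumeration [enum_val] of SP N. *)
Definition Cmx (N M : nat) : 'M[Qt]_(#|SP N|) :=
  \matrix_(i, j) specialize_ts M (Cts (enum_val i) (enum_val j)).

(* Main.v *)
Require Import Defs.
From mathcomp Require Import all_boot all_order all_algebra finmap.
From mathcomp.classical Require Import boolp classical_sets.
From mathcomp.multinomials Require Import monalg.
From mathcomp Require Import ring zify.
Import GRing.Theory.

Set Implicit Arguments.
Unset Strict Implicit.
Unset Printing Implicit Defensive.

(* The matrices C_N^[M](t) are simultaneously diagonalized over Q: T_{t,s} acts
   on power sum monomials by scalars, so C_N^[M](t) = B D_M A, where A and
   B = A^-1 are the rational transition matrices between the Q_lambda and power
   sum monomials, and the diagonal entries of D_M are products of the ratios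
   (1 - t^(M n)) / (1 - t^n), n odd. The identities are then those of the ratios.

   That the Q_lambda form a basis is proved by a triangularity and a count. From
   exp(G(z)) exp(G(-z)) = 1 one gets q_m^2 in terms of products q_(m+k) q_(m-k)
   with k > 0, and the expansion of the Pfaffian gives Q_lambda = q_lambda + terms
   q_mu with a larger sum of squares of parts; by descending induction on this sum
   all products of q's are rational combinations of the Q_lambda, and so are the
   power sums by Newton's identities. Glaisher's map from strict partitions to
   partitions into odd parts is injective, hence yields as many linearly
   independent power sum monomials as there are Q_lambda in each degree. *)

(** * Glaisher's map *)

(** Uniqueness of binary digits: parity determines digit 0, and halving the rest shifts the
    remaining digits down by one. *)
Lemma binary_inj m (f g : nat -> bool) :
  (\sum_(a < m) f a * 2 ^ a = \sum_(a < m) g a * 2 ^ a)%N ->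
  forall a, (a < m)%N -> f a = g a.
Proof.
elim: m f g => // m IHm f g; rewrite !big_ord_recl !muln1.
have half (h : nat -> bool) :
    (\sum_(i < m) h (lift ord0 i) * 2 ^ lift ord0 i
      = (\sum_(i < m) h i.+1 * 2 ^ i).*2)%N.
  rewrite -mul2n big_distrr /=; apply: eq_bigr => i _.
  by rewrite /bump /= add1n expnS mulnCA.
rewrite !half => E; have fg0 : f 0%N = g 0%N.
  by have := congr1 odd E; rewrite !oddD !odd_double !addbF !oddb.
case=> [//|a]; rewrite ltnS => lt_am; apply: (IHm (f \o S) (g \o S)) => //.
by apply: double_inj; move: E; rewrite fg0 => /addnI.
Qed.

(* Glaisher's map: the part n = 2^v (2 i + 1) becomes 2^v copies of 2 i + 1. *)
Definition glaisher (la : seq nat) : {cmonom nat} :=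
  \big[mmul/mone]_(n <- la) \big[mmul/mone]_(j < n`_2%N) ucm (n`_2^')%N./2.

Lemma glaisherE la i :
  glaisher la i = (\sum_(n <- la) ((n`_2^')./2 == i) * n`_2)%N.
Proof.
have mM : {morph (fun m : {cmonom nat} => m i) : x y / mmul x y >-> (x + y)%N}.
  by move=> x y; exact: cmM.
rewrite /glaisher (big_morph _ mM (cm1 i)); apply: eq_bigr => n _.
rewrite (big_morph _ mM (cm1 i)) (eq_bigr (fun=> ((n`_2^')%N./2 == i) : nat)).
  by rewrite sum_nat_const card_ord mulnC.
by move=> j _; rewrite cmU.
Qed.

Lemma partn_pow2_odd a i :
  ((2 ^ a * i.*2.+1)`_2 = 2 ^ a /\ (2 ^ a * i.*2.+1)`_2^' = i.*2.+1)%N.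
Proof.
have odd_i : (2^'.-nat i.*2.+1)%N by rewrite -odd_2'nat /= odd_double.
have pow_a : (2.-nat (2 ^ a))%N by rewrite pnatX pnat_id ?orbT.
rewrite !partnM ?expn_gt0 // (part_pnat_id pow_a) (part_p'nat odd_i) muln1.
by rewrite (part_pnat_id odd_i) part_p'nat ?mul1n // pnatNK.
Qed.

Lemma odd_part n : (0 < n)%N -> (n`_2^' = (n`_2^')./2.*2.+1)%N.
Proof.
move=> n_gt0; rewrite -[LHS]odd_double_half.
by rewrite [odd _]odd_2'nat part_pnat.
Qed.

(** Since the parts are distinct, each [2 ^ a] is contributed at most once to the multiplicity of
    [i.*2.+1], so this is its binary expansion. Exponents up to [N] suffice because [2 ^ a] is at
    most a part, hence at most [N]. *)
Lemma glaisher_binary N (la : SP N) i :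
  glaisher la i = (\sum_(a < N.+1) ((2 ^ a * i.*2.+1)%N \in val la) * 2 ^ a)%N.
Proof.
rewrite glaisherE; have /and3P[la_dec la_pos /eqP laN] := valP la.
have la_uniq : uniq (val la).
  by apply: (sorted_uniq _ _ la_dec) => [x y z xy yz|x]; rewrite /= ?ltnn //; lia.
under [RHS]eq_bigr do
  rewrite -count_uniq_mem // -sum1_count big_mkcond big_distrl /=.
rewrite exchange_big /= !big_seq; apply: eq_bigr => n n_la.
have n_gt0 : (0 < n)%N := allP la_pos n n_la.
have nE : n = (n`_2 * (n`_2^')./2.*2.+1)%N by rewrite -odd_part // partnC.
have le_nN : (n <= N)%N.
  by rewrite -laN sumnE (big_rem n n_la) /= leq_addr.
set j := (n`_2^')./2 in nE *; case: eqVneq => [<-|neq_ji].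
  have lt_N : (logn 2 n < N.+1)%N.
    by rewrite ltnS (leq_trans _ le_nN) // ltnW // ltn_logl.
  (* Only the 2-adic valuation of [n] can serve as the exponent [a]. *)
  rewrite (bigD1 (Ordinal lt_N)) //= -p_part -nE eqxx big1 ?addn0 // => a ne_a.
  case: eqP => // E; case/eqP: ne_a; apply: val_inj => /=.
  apply/eqP; rewrite -(eqn_exp2l _ _ (isT : 1 < 2)) -p_part E.
  by rewrite !(partn_pow2_odd _ _).1.
rewrite mul0n big1 // => a _; case: eqP => // E; case/eqP: neq_ji.
by rewrite /j E (partn_pow2_odd _ _).2 /= uphalf_double.
Qed.

(** Equal multiplicities have equal binary digits, and these digits record which parts are
    present. *)
Lemma glaisher_inj N : injective (fun la : SP N => glaisher la).
Proof.
move=> la mu /= E; apply: val_inj.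
have sub (la1 mu1 : SP N) :
    glaisher la1 = glaisher mu1 -> {subset val la1 <= val mu1}.
  move=> {}E n n_la; have /and3P[_ la_pos /eqP laN] := valP la1.
  have n_gt0 : (0 < n)%N := allP la_pos n n_la.
  have nE : (2 ^ logn 2 n * (n`_2^')./2.*2.+1 = n)%N.
    by rewrite -odd_part // -p_part partnC.
  have le_nN : (n <= N)%N by rewrite -laN sumnE (big_rem n n_la) /= leq_addr.
  have lt_N : (logn 2 n < N.+1)%N.
    by rewrite ltnS (leq_trans _ le_nN) // ltnW // ltn_logl.
  have := congr1 (fun m : {cmonom nat} => m (n`_2^')./2) E.
  rewrite !glaisher_binary.
  pose f (s : SP N) a := (2 ^ a * (n`_2^')./2.*2.+1)%N \in val s.
  move=> /(@binary_inj _ (f la1) (f mu1))/(_ _ lt_N).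
  by rewrite /f nE n_la => <-.
apply: (@irr_sorted_eq _ gtn) => [x y z xy yz|x|||x].
- exact: ltn_trans yz xy.
- exact: ltnn.
- by case/and3P: (valP la).
- by case/and3P: (valP mu).
- by apply/idP/idP; apply: sub.
Qed.

Local Open Scope ring_scope.

(** * The generating function of the q_r *)

Section PolyCoef.
Variable A : comNzRingType.
Implicit Types p u : {poly A}.

Lemma coef_exp_congr p u r :
  (forall i, (i <= r)%N -> p`_i = u`_i) ->
  forall k i, (i <= r)%N -> (p ^+ k)`_i = (u ^+ k)`_i.
Proof.
move=> pu; elim=> [|k IHk] i le_ir; first by rewrite !expr0.
rewrite !exprS !coefM; apply: eq_bigr => j _.
by rewrite pu ?IHk ?(leq_trans _ le_ir) ?leq_subr // -ltnS.
Qed.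

Lemma coef_exp_eq0 p k i : p`_0 = 0 -> (i < k)%N -> (p ^+ k)`_i = 0.
Proof.
move=> p0 lt_ik; rewrite -(poly_take_drop 1 p) (_ : take_poly 1 p = 0).
  by rewrite add0r expr1 exprMn coefMXn lt_ik.
by apply/polyP=> -[|j]; rewrite coef_take_poly coef0.
Qed.

Lemma coef_comp_polyNX p i : (p \Po (- 'X))`_i = (-1) ^+ i * p`_i.
Proof.
rewrite -[p]coefK poly_def rmorph_sum /= !coef_sum mulr_sumr.
apply: eq_bigr => j _; rewrite comp_polyZ rmorphXn /= comp_polyX (exprNn 'X).
have -> : (-1) ^+ j = ((-1) ^+ j)%:P :> {poly A} by rewrite rmorphXn rmorphN1.
rewrite !coefZ coefCM coefXn; case: eqVneq => [->|_]; rewrite ?mulr0 //.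
by rewrite !mulr1 mulrC.
Qed.

End PolyCoef.

(** Folding about the middle index brings the orthogonality relation of the [q]'s into the shape of
    the formula defining [Q2]. *)
Lemma sum_centered (V : nmodType) (F : nat -> V) m :
  \sum_(0 <= i < m.*2.+1) F i
  = F m + \sum_(1 <= k < m.+1) (F (m + k)%N + F (m - k)%N).
Proof.
rewrite (big_cat_nat (n := m)) /= ?leqW -?addnn ?leq_addr //.
rewrite [X in _ + X]big_ltn ?ltnS ?leq_addr // addrCA; congr (_ + _).
rewrite big_split /= addrC; congr (_ + _).
  rewrite -{1}[m.+1]add1n big_addn subSn ?addnK; last by rewrite leq_addr.
  by apply: eq_bigr => i _; rewrite addnC.
rewrite big_nat_rev big_add1 /=; apply: eq_big_nat => i _.
by rewrite add0n subnS.
Qed.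

Section Texp.
Variables (K : fieldType) (sg : {rmorphism rat -> K}) (A : comAlgType K).

Lemma natf_neq0_rat n : (0 < n)%N -> n%:R != 0 :> K.
Proof.
by move=> n_gt0; rewrite -(rmorph_nat sg) fmorph_eq0 Num.Theory.pnatr_eq0 -lt0n.
Qed.

Lemma algmulrn_eq0 (x : A) n : (0 < n)%N -> x *+ n = 0 -> x = 0.
Proof.
move=> n_gt0; rewrite -scaler_nat => /eqP; rewrite scaler_eq0.
by rewrite (negPf (natf_neq0_rat n_gt0)) => /eqP.
Qed.

(** The exponential series of [G], cut after the term in [G ^+ n]. *)
Definition texp (n : nat) (G : {poly A}) : {poly A} :=
  \sum_(k < n.+1) ((k`!%:R^-1 : K)%:A : A) *: G ^+ k.

Lemma coef_texp n G i :
  (texp n G)`_i = \sum_(k < n.+1) (k`!%:R^-1 : K) *: (G ^+ k)`_i.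
Proof. by rewrite coef_sum; apply: eq_bigr => k _; rewrite coefZ mulr_algl. Qed.

Lemma texpS n G :
  texp n.+1 G = texp n G + ((n.+1)`!%:R^-1 : K)%:A *: G ^+ n.+1.
Proof. by rewrite /texp big_ord_recr. Qed.

(** Differentiation lowers the truncation order by one, so the differential equation of the
    exponential holds without error term. *)
Lemma deriv_texp n G : (texp n.+1 G)^`() = G^`() * texp n G.
Proof.
elim: n => [|n IHn].
  rewrite texpS /texp !big_ord1 expr1 fact0 !derivE invr1 !scale1r.
  by rewrite add0r expr0 mulr1.
rewrite texpS derivD IHn [in RHS]texpS mulrDr; congr (_ + _).
rewrite derivZ deriv_exp /= -scalerMnr scalerMnl -scalerAr mulrC.
congr (_ *: _). rewrite scalerMnl; congr (_ *: _); rewrite -mulr_natr factS.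
rewrite natrM invfM mulrAC mulVf ?mul1r //; exact: natf_neq0_rat.
Qed.

End Texp.

Section Qfun.
Variables (K : fieldType) (sg : {rmorphism rat -> K}).
Local Notation q := (qfun K).

Lemma logq0 r : (logq K r)`_0 = 0.
Proof. by rewrite coef_poly. Qed.

Lemma coef_logq r i : (i <= r)%N ->
  (logq K r)`_i = if odd i then (2%:R / i%:R : K) *: pvar K i else 0.
Proof. by move=> le_ir; rewrite coef_poly ltnS le_ir. Qed.

(** As [logq] has no constant term, its powers beyond the [i]-th do not reach degree [i]; hence
    neither truncation affects the coefficient. *)
Lemma coef_texp_logq n r i :
  (i <= n)%N -> (i <= r)%N -> (texp n (logq K r))`_i = q i.
Proof.
move=> le_in le_ir; rewrite coef_texp /qfun.
rewrite -(big_mkord xpredT (fun k => (k`!%:R^-1 : K) *: (logq K r ^+ k)`_i)).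
rewrite (big_cat_nat (n := i.+1)) //=.
rewrite [X in _ + X]big_nat_cond [X in _ + X]big1 ?addr0.
  rewrite big_mkord; apply: eq_bigr => k _; congr (_ *: _).
  apply: coef_exp_congr (leqnn i) => j le_ji.
  by rewrite !coef_logq ?(leq_trans le_ji).
by move=> k /andP[/andP[lt_ik _] _]; rewrite coef_exp_eq0 ?logq0 ?scaler0.
Qed.

Lemma qfun0 : q 0 = 1.
Proof. by rewrite /qfun big_ord1 fact0 invr1 scale1r expr0 coef1. Qed.

(** Coefficient of [z^n] in F' = G' F, where F = exp(G). *)
Lemma qfun_newton n :
  q n.+1 *+ n.+1
  = \sum_(i < n.+1) (if odd i then 0 else pvar K i.+1 *+ 2) * q (n - i).
Proof.
have := congr1 (fun p : {poly Gamma K} => p`_n) (deriv_texp sg n (logq K n.+1)).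
rewrite coef_deriv coef_texp_logq // => ->; rewrite coefM.
apply: eq_bigr => i _; have le_in : (i <= n)%N by rewrite -ltnS.
have le_sub : (n - i <= n)%N by rewrite leq_subr.
rewrite (coef_texp_logq le_sub (leqW le_sub)); congr (_ * _).
rewrite coef_deriv (coef_logq (le_in : (i < n.+1)%N)) oddS.
case: odd => /=; first by rewrite mul0rn.
by rewrite -scaler_nat scalerA mulrC divfK ?(natf_neq0_rat sg) // scaler_nat.
Qed.

(** This is the coefficient of degree [n.+1] of H = F(-z) F(z). As G is odd, H would be constant for
    the full exponential; with truncation, H' is still divisible by [G ^+ n.+1], hence has no
    coefficient in degree [n]. *)
Lemma qfun_orth n :
  \sum_(i < n.+2) (-1) ^+ i * q i * q (n.+1 - i) = 0.
Proof.
set G := logq K n.+1; set F := texp n.+1 G.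
set c : Gamma K := ((n.+1)`!%:R^-1 : K)%:A.
have GN : G \Po (- 'X) = - G.
  apply/polyP=> i; rewrite coef_comp_polyNX coefN coef_poly.
  case: ifP => _; last by rewrite mulr0 oppr0.
  by rewrite -signr_odd; case: odd; rewrite ?mulr0 ?oppr0 // mulN1r.
have dGN : G^`() \Po (- 'X) = G^`().
  have := congr1 (fun p : {poly Gamma K} => p^`()) GN.
  by rewrite deriv_comp !derivN derivX mulrN1 => /oppr_inj.
have dF : F^`() = G^`() * (F - c *: G ^+ n.+1).
  by rewrite (deriv_texp sg) /F texpS addrK.
pose H := (F \Po (- 'X)) * F.
(* The main parts of the two summands of H' cancel because G' is even; only the last terms of the
   truncations remain. *)
have dH : exists u, H^`() = u * G ^+ n.+1.
  exists (c *: (G^`() * ((-1) ^+ n.+1 * F - (F \Po (- 'X))))).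
  rewrite derivM deriv_comp dF derivN derivX rmorphM rmorphB /= dGN.
  rewrite comp_polyZ rmorphXn /= GN (exprNn G) -!mul_polyC.
  move: (F \Po _) (G ^+ _) ((-1) ^+ _) => Fm Gn s; ring.
have : H^`()`_n = 0.
  have [u ->] := dH; rewrite coefM big1 // => i _.
  by rewrite coef_exp_eq0 ?logq0 ?mulr0 // ltnS leq_subr.
rewrite coef_deriv => /(algmulrn_eq0 sg) H0; rewrite -[RHS]H0 // coefM.
apply: eq_bigr => i _; have le_in : (i <= n.+1)%N by rewrite -ltnS.
by rewrite coef_comp_polyNX !coef_texp_logq ?leq_subr.
Qed.

(** Folded about its middle term, the orthogonality relation in degree [m.*2] is
    [(-1) ^+ m * Q2 K m m]. *)
Lemma Q2_diag m : (0 < m)%N -> Q2 K m m = 0.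
Proof.
move=> m_gt0; have := qfun_orth (m.*2).-1.
rewrite prednK ?double_gt0 // => H.
have : \sum_(0 <= i < m.*2.+1) (-1) ^+ i * q i * q (m.*2 - i) = 0.
  by rewrite big_mkord.
rewrite sum_centered -addnn addnK => {}H.
suff : (-1) ^+ m * Q2 K m m = 0.
  by move/(congr1 (fun x => (-1) ^+ m * x)); rewrite mulr0 signrMK.
rewrite -[RHS]H /Q2 mulrDr mulrA; congr (_ + _).
rewrite mulrnAr -mulrnAl mulr_sumr.
apply: eq_big_nat => k /andP[_ le_km].
have -> : (m + m - (m + k) = m - k)%N by lia.
have -> : (m + m - (m - k) = m + k)%N by lia.
have -> : (-1) ^+ (m - k) = (-1) ^+ (m + k) :> Gamma K.
  by rewrite -signr_odd -[RHS]signr_odd oddB // oddD.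
rewrite exprD; move: (q _) (q _) (_ ^+ m) (_ ^+ k) => x y a b; ring.
Qed.

End Qfun.

(** * Leading terms of the Schur Q-functions *)

Lemma big_ord_lift2 (R : Type) (idx : R) (op : Monoid.com_law idx) n
    (j : 'I_n.+1) (F : 'I_n.+2 -> R) :
  \big[op/idx]_i F i = op (op (F ord0) (F (lift ord0 j)))
    (\big[op/idx]_i F (lift ord0 (lift j i))).
Proof. by rewrite big_ord_recl (bigD1_ord j) //= Monoid.mulmA. Qed.

Section RationalSpan.
Variables (K : fieldType) (sg : {rmorphism rat -> K}).

(** Coefficients are kept in the image of the rationals, so that the transition matrices obtained
    later are unaffected by substitutions for t and s. *)
Inductive rspan (V : lmodType K) (S : V -> Prop) : V -> Prop :=
| rspan0 : rspan S 0
| rspan_cons (a : rat) s v : S s -> rspan S v -> rspan S (sg a *: s + v).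

Section Module.
Variable V : lmodType K.
Implicit Types (S : V -> Prop) (u v : V).

Lemma rspanD S u v : rspan S u -> rspan S v -> rspan S (u + v).
Proof.
move=> Su Sv; elim: Su => [|a s w Ss _ IHw]; first by rewrite add0r.
by rewrite -addrA; apply: rspan_cons.
Qed.

Lemma rspanZ S a v : rspan S v -> rspan S (sg a *: v).
Proof.
elim=> [|b s w Ss _ IHw]; first by rewrite scaler0; apply: rspan0.
by rewrite scalerDr scalerA -rmorphM; apply: rspan_cons.
Qed.

Lemma rspan_gen S v : S v -> rspan S v.
Proof.
by move=> Sv; rewrite -[v]addr0 -[v]scale1r -(rmorph1 sg); apply/rspan_cons/rspan0.
Qed.

Lemma rspanN S v : rspan S v -> rspan S (- v).
Proof. by move=> Sv; rewrite -scaleN1r -(rmorphN1 sg); apply: rspanZ. Qed.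

Lemma rspanB S u v : rspan S u -> rspan S v -> rspan S (u - v).
Proof. by move=> Su Sv; apply/rspanD/rspanN. Qed.

Lemma rspanMn S v n : rspan S v -> rspan S (v *+ n).
Proof. by move=> Sv; rewrite -scaler_nat -(rmorph_nat sg); apply: rspanZ. Qed.

Lemma rspan_sum S (I : Type) (r : seq I) (P : pred I) (F : I -> V) :
  (forall i, P i -> rspan S (F i)) -> rspan S (\sum_(i <- r | P i) F i).
Proof. by move=> SF; apply: big_ind => //; [apply: rspan0 | apply: rspanD]. Qed.

Lemma rspan_trans S S' v :
  (forall s, S s -> rspan S' s) -> rspan S v -> rspan S' v.
Proof.
move=> SS'; elim=> [|a s w Ss _ IHw]; first exact: rspan0.
by apply: rspanD => //; apply/rspanZ/SS'.
Qed.

Lemma rspan_coord (I : finType) (F : I -> V) v :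
  rspan (fun w => exists i, w = F i) v ->
  exists f : I -> rat, v = \sum_i sg (f i) *: F i.
Proof.
elim=> [|a s w [i ->] _ [f ->]].
  by exists (fun=> 0); rewrite big1 // => i _; rewrite rmorph0 scale0r.
exists (fun j => (if j == i then a else 0) + f j).
under [RHS]eq_bigr do rewrite rmorphD scalerDl.
rewrite big_split /=; congr (_ + _).
rewrite (bigD1 i) //= eqxx big1 ?addr0 // => j /negPf ->.
by rewrite rmorph0 scale0r.
Qed.

End Module.

Lemma rspan_sign (A : lalgType K) (S : A -> Prop) n v :
  rspan S v -> rspan S ((-1) ^+ n * v).
Proof.
by rewrite -signr_odd; case: odd => Sv; rewrite ?mulN1r ?mul1r //; apply: rspanN.
Qed.

Lemma rspanM (A : algType K) (S1 S2 S : A -> Prop) u v :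
  (forall s1 s2, S1 s1 -> S2 s2 -> S (s1 * s2)) ->
  rspan S1 u -> rspan S2 v -> rspan S (u * v).
Proof.
move=> S12 Su Sv; elim: Su => [|a s w S1s _ IHw]; first by rewrite mul0r; left.
rewrite mulrDl -scalerAl; apply: rspanD => //; apply: rspanZ.
elim: Sv => [|b s' w' S2s _ IHw']; first by rewrite mulr0; left.
by rewrite mulrDr -scalerAr; apply: rspan_cons => //; apply: S12.
Qed.

End RationalSpan.

Section Raising.
Variables (K : fieldType) (sg : {rmorphism rat -> K}).
Local Notation q := (qfun K).

Definition qprod (s : seq nat) : Gamma K := \prod_(x <- s) q x.

(** A filtration, decreasing in [c], on products of total index [N]. The sum of squares is additive
    under concatenation, which makes the filtration multiplicative. The list [s] may be unordered
    and may contain repetitions and zeros. *)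
Definition qraise (N c : nat) : Gamma K -> Prop :=
  rspan sg (fun v => exists s : seq nat,
    [/\ \sum_(x <- s) x = N, c <= \sum_(x <- s) x ^ 2 & v = qprod s]%N).

Lemma qraise_le N c c' v : (c <= c')%N -> qraise N c' v -> qraise N c v.
Proof.
move=> le_c; apply: rspan_trans => _ [s [sN sc ->]]; apply: rspan_gen.
by exists s; split=> //; apply: leq_trans sc.
Qed.

Lemma qraiseM N1 N2 c1 c2 u v :
  qraise N1 c1 u -> qraise N2 c2 v -> qraise (N1 + N2) (c1 + c2) (u * v).
Proof.
apply: rspanM => _ _ [s1 [<- c1s ->]] [s2 [<- c2s ->]]; exists (s1 ++ s2).
by rewrite /qprod !big_cat; split=> //; apply: leq_add.
Qed.

Lemma qraise_qprod (s : seq nat) :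
  qraise (\sum_(x <- s) x) (\sum_(x <- s) x ^ 2) (qprod s).
Proof. by apply: rspan_gen; exists s. Qed.

Lemma qraise_q n : qraise n (n ^ 2) (q n).
Proof. by have := qraise_qprod [:: n]; rewrite /qprod !big_seq1. Qed.

Lemma qraise1 : qraise 0 0 1.
Proof. by have := qraise_qprod [::]; rewrite /qprod !big_nil. Qed.

(* [v] has leading term [u], with respect to the number of boxes [N] and the
   sum of squares [c] of the index of [u]. *)
Definition qlead (N c : nat) (u v : Gamma K) : Prop :=
  qraise N c u /\ qraise N c.+1 (v - u).

Lemma qlead_raise N c u v : qlead N c u v -> qraise N c v.
Proof.
move=> [Hu Hvu]; rewrite -(subrK u v).
by apply: rspanD => //; apply: qraise_le Hvu.
Qed.

Lemma qleadM N1 N2 c1 c2 u1 u2 v1 v2 :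
  qlead N1 c1 u1 v1 -> qlead N2 c2 u2 v2 ->
  qlead (N1 + N2) (c1 + c2) (u1 * u2) (v1 * v2).
Proof.
move=> H1 H2; split; first by apply: qraiseM; [case: H1 | case: H2].
rewrite (_ : _ - _ = (v1 - u1) * v2 + u1 * (v2 - u2)); last by ring.
apply: rspanD.
  by rewrite -addSn; apply: qraiseM; [case: H1 | apply: qlead_raise H2].
by rewrite -addnS; apply: qraiseM; [case: H1 | case: H2].
Qed.

(** Passing from (r, s) to (r + k, s - k) raises the sum of squares by 2k(r - s) + 2k^2, which is
    positive for k > 0. *)
Lemma qlead_Q2 r s : (s <= r)%N ->
  qlead (r + s) (r ^ 2 + s ^ 2) (q r * q s) (Q2 K r s).
Proof.
move=> le_sr; split; first by apply: qraiseM; apply: qraise_q.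
rewrite /Q2 addrC addKr; apply: rspanMn; rewrite big_nat; apply: rspan_sum.
move=> k /andP[k_gt0 le_ks]; rewrite -mulrA; apply: rspan_sign.
have := qraiseM (qraise_q (r + k)) (qraise_q (s - k)).
rewrite (_ : r + k + (s - k) = r + s)%N; last by lia.
by apply: qraise_le; rewrite -!mulnn; nia.
Qed.

(* Every perfect matching contributes the leading term [\prod_i q (x i)], and
   the signs of the matchings add up to 1. *)
Lemma qlead_pfaffian m (x : 'I_(m.*2) -> nat) (A : 'M[Gamma K]_(m.*2)) :
  (forall i j : 'I_(m.*2), (i <= j)%N -> (x j <= x i)%N) ->
  (forall i j : 'I_(m.*2), (i < j)%N -> A i j = Q2 K (x i) (x j)) ->
  qlead (\sum_i x i) (\sum_i x i ^ 2) (\prod_i q (x i)) (pfaffian A).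
Proof.
elim: m x A => [|m IHm] x A x_dec A_Q2.
  split; rewrite !big_ord0 ?subrr; [exact: qraise1 | exact: rspan0].
have lead j : qlead (\sum_i x i) (\sum_i x i ^ 2) (\prod_i q (x i))
    (A ord0 (lift ord0 j) * pfaffian (col' j (col' ord0 (row' j (row' ord0 A))))).
  rewrite (big_ord_lift2 _ j) [X in qlead _ X](big_ord_lift2 _ j).
  rewrite [X in qlead _ _ X](big_ord_lift2 _ j) /= A_Q2 //.
  apply: qleadM; first by apply: qlead_Q2; exact: x_dec.
  apply: IHm => [i k le_ik|i k lt_ik].
    by apply: x_dec; rewrite !lift0 ltnS leq_bump2.
  by rewrite !mxE A_Q2 // !lift0 ltnS ltnNge leq_bump2 -ltnNge.
split.
  rewrite -(big_map x xpredT q) -(big_map x xpredT id).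
  by rewrite -(big_map x xpredT (fun i => i ^ 2)%N); exact: qraise_qprod.
(* The row expansion has an odd number of alternating signs, so the leading term can be distributed
   over it and compared summand by summand. *)
have -> : \prod_i q (x i) = \sum_(j < m.*2.+1) (-1) ^+ j * \prod_i q (x i).
  rewrite -mulr_suml (_ : \sum_j _ = 1) ?mul1r //.
  elim: (m) => [|k IHk]; first by rewrite big_ord1 expr0.
  by rewrite doubleS big_ord_recr big_ord_recr /= IHk [_ ^+ _.+2]exprS mulN1r addrK.
rewrite /= -sumrB; apply: rspan_sum => j _; rewrite -mulrA -mulrBr.
by apply: rspan_sign; case: (lead j).
Qed.

End Raising.

(** * Spanning by the Schur Q-functions *)

Lemma big_nth_pad (R T : Type) (idx : R) (op : Monoid.law idx) (x0 : T)
    (s : seq T) m (F : T -> R) :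
  (size s <= m)%N -> F x0 = idx ->
  \big[op/idx]_(i < m) F (nth x0 s i) = \big[op/idx]_(x <- s) F x.
Proof.
move=> le_sm Fx0; rewrite -(big_mkord xpredT (fun i => F (nth x0 s i))).
rewrite (big_cat_nat (n := size s)) //= [RHS](big_nth x0) [X in op _ X]big_nat.
by rewrite [X in op _ X]big1 ?Monoid.mulm1 // => i /andP[/(nth_default x0) ->].
Qed.

Lemma not_uniq_perm (T : eqType) (s : seq T) :
  ~~ uniq s -> exists a s', perm_eq s [:: a, a & s'].
Proof.
elim: s => //= x s IHs; rewrite negb_and negbK => /orP[x_s|/IHs[a [s' s_a]]].
  by exists x, (rem x s); rewrite perm_cons perm_to_rem.
exists a, (x :: s'); rewrite -(perm_cons x) in s_a; apply: perm_trans s_a _.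
by apply/permP => p /=; lia.
Qed.

(** This bound makes the descending induction on the sum of squares terminate. *)
Lemma sumn_sq_le (s : seq nat) :
  (\sum_(x <- s) x ^ 2 <= (\sum_(x <- s) x) ^ 2)%N.
Proof.
elim: s => [|x s IHs]; first by rewrite !big_nil.
by rewrite !big_cons sqrnD -addnA leq_add2l (leq_trans IHs) // leq_addr.
Qed.

Section Spanning.
Variables (K : fieldType) (sg : {rmorphism rat -> K}).
Local Notation q := (qfun K).

Definition Qspan (N : nat) : Gamma K -> Prop :=
  rspan sg (fun v => exists la : SP N, v = schurQ K la).

Lemma qlead_schurQ N (la : SP N) :
  qlead sg N (\sum_(x <- la) x ^ 2) (qprod K la) (schurQ K la).
Proof.
have /and3P[la_dec _ /eqP laN] := valP la.
have le_sz : (size la <= (uphalf (size la)).*2)%N.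
  by rewrite -[leqLHS]odd_double_half uphalf_half doubleD; case: odd; lia.
have := @qlead_pfaffian K sg _ (fun i => nth 0%N la i) (Qmx K la).
(* A zero part appended for parity changes neither the two sums nor, as [q 0 = 1], the product. *)
rewrite (big_nth_pad (F := id) _ le_sz) //.
rewrite (big_nth_pad (F := expn^~ 2) _ le_sz) //.
rewrite (big_nth_pad (F := q) _ le_sz) ?qfun0 //.
rewrite -sumnE laN; apply => i j le_ij; last by rewrite mxE le_ij.
have [lt_j|/(nth_default 0%N) -> //] := ltnP j (size la).
have geq_la : sorted geq la by apply: sub_sorted la_dec => x y /ltnW.
apply: (sorted_leq_nth (leT := geq)) => //; rewrite ?inE ?(leq_ltn_trans le_ij) //.
  by move=> x y z xy yz; exact: leq_trans yz xy.
exact: leqnn.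
Qed.

Lemma qprod_pos (s : seq nat) : qprod K s = qprod K (filter (leq 1) s).
Proof.
rewrite /qprod big_filter [LHS](bigID (leq 1)) /= [X in _ * X]big1 ?mulr1 //.
by case=> // _; exact: qfun0.
Qed.

(** Descending induction on the sum of squares, after removal of zeros. Distinct parts give some
    Q_lambda up to higher terms; a repeated part [a] gives only higher terms, since [q a * q a] is
    the leading term of [Q2 K a a = 0]. *)
Lemma Qspan_qprod N (s : seq nat) :
  \sum_(x <- s) x = N -> Qspan N (qprod K s).
Proof.
have [d] := ubnP (N ^ 2 - \sum_(x <- s) x ^ 2)%N; elim: d s => // d IHd s.
rewrite ltnS => le_d sN.
have span_gt v : qraise sg N (\sum_(x <- s) x ^ 2).+1 v -> Qspan N v.
  apply: rspan_trans => _ [s' [s'N s'c ->]]; apply: IHd => //.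
  by have := sumn_sq_le s'; rewrite s'N; lia.
pose t := filter (leq 1) s.
have sum_t (F : nat -> nat) : F 0%N = 0%N ->
    (\sum_(x <- t) F x = \sum_(x <- s) F x)%N.
  move=> F0; rewrite big_filter [RHS](bigID (leq 1)) /= [X in (_ + X)%N]big1.
    by rewrite addn0.
  by case.
have tN : (\sum_(x <- t) x = N)%N by rewrite sum_t.
rewrite qprod_pos -/t; have [t_uniq|/not_uniq_perm[a [s' t_a]]] := boolP (uniq t).
  pose r := sort geq t.
  have r_t : perm_eq t r by rewrite perm_sym perm_sort.
  have rP : is_strict_part N r.
    apply/and3P; split.
    - by rewrite gtn_sorted_uniq_geq /r sort_uniq t_uniq sort_sorted.
    - by rewrite -(perm_all _ r_t) filter_all.
    - by rewrite sumnE -(perm_big _ r_t) /= tN.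
  have [_] := qlead_schurQ (StrictPart rP).
  rewrite /= -(perm_big _ r_t) /= sum_t // => /span_gt lead.
  rewrite /qprod (perm_big _ r_t) /= -/(qprod K r).
  rewrite -[qprod K r](subKr (schurQ K r)); apply: rspanB => //.
  by apply: rspan_gen; exists (StrictPart rP).
(* Positivity of [a] matters here, because [Q2 K 0 0 = 1]. *)
have a_gt0 : (0 < a)%N.
  by apply: (allP (filter_all (leq 1) s)); rewrite -/t (perm_mem t_a) inE eqxx.
apply: span_gt; rewrite -(sum_t (expn^~ 2)) // -tN /qprod.
rewrite !(perm_big _ t_a) !big_cons /= !addnA mulrA -addSn; apply: qraiseM.
  have [_] := qlead_Q2 sg (leqnn a).
  by rewrite (Q2_diag sg a_gt0) sub0r => /rspanN; rewrite opprK.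
exact: qraise_qprod.
Qed.

Lemma Qspan_qraise N v : qraise sg N 0 v -> Qspan N v.
Proof. by apply: rspan_trans => _ [s [sN _ ->]]; exact: Qspan_qprod. Qed.

(** Newton's identity is solved for its last term, twice the power sum, and 2 is invertible over the
    rationals. *)
Lemma qraise_pvar n : odd n -> qraise sg n 0 (pvar K n).
Proof.
have [d] := ubnP n; elim: d n => // d IHd [//|n]; rewrite ltnS => le_nd n_even.
have := qfun_newton sg n; rewrite big_ord_recr subnn /= qfun0 [X in _ + X]mulr1.
rewrite (_ : odd n = false); last exact: negbTE.
set S := (X in X + _) => qE.
have p2 : qraise sg n.+1 0 (pvar K n.+1 *+ 2).
  rewrite (_ : _ *+ 2 = q n.+1 *+ n.+1 - S); last by rewrite qE [RHS]addrC addKr.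
  apply: rspanB.
    by apply: rspanMn; apply: qraise_le (qraise_q _ _).
  apply: rspan_sum => i _; case: ifP => [_|/negbT i_even].
    by rewrite mul0r; exact: rspan0.
  have -> : (n.+1 = i.+1 + (n - i))%N by have := ltn_ord i; lia.
  apply: (@qraiseM _ _ _ _ 0 0); last by apply: qraise_le (qraise_q _ _).
  by apply: rspanMn; apply: IHd => //; apply: leq_ltn_trans le_nd.
have := rspanZ 2%:R^-1 p2; rewrite -scaler_nat scalerA fmorphV rmorph_nat.
by rewrite mulVf ?scale1r // (natf_neq0_rat sg).
Qed.

End Spanning.

(** * The basis of Schur Q-functions *)

Section LinearCombination.
Variables (K : fieldType) (V : lmodType K).

Lemma lincomb_mulmx m n p (u : 'M[K]_(m, n)) (A : 'M[K]_(n, p))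
    (x : 'I_p -> V) (y : 'I_n -> V) :
  (forall j, y j = \sum_k A j k *: x k) ->
  forall i, \sum_j u i j *: y j = \sum_k (u *m A) i k *: x k.
Proof.
move=> yE i; under eq_bigr do rewrite yE scaler_sumr.
rewrite exchange_big; apply: eq_bigr => k _; rewrite mxE scaler_suml.
by apply: eq_bigr => j _; rewrite scalerA.
Qed.

Lemma lincomb_mx1 n (x : 'I_n -> V) i : \sum_k (1%:M : 'M[K]_n) i k *: x k = x i.
Proof.
rewrite (bigD1 i) //= mxE eqxx scale1r big1 ?addr0 // => k ne_ki.
by rewrite mxE eq_sym (negPf ne_ki) scale0r.
Qed.

End LinearCombination.

Section Basis.
Variables (K : fieldType) (sg : {rmorphism rat -> K}).

(** Labelling power sum monomials by strict partitions gives them the index set of the Q_lambda, so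
    the transition matrices are square. *)
Definition pmon (la : seq nat) : Gamma K := mkmalgU (glaisher la) 1.

Lemma pmonE la : pmon la = \prod_(n <- la) pvar K n`_2^'%N ^+ n`_2%N.
Proof.
have mM : {morph (fun m : {cmonom nat} => mkmalgU m 1 : Gamma K) :
    x y / mmul x y >-> x * y}.
  by move=> x y; rewrite [RHS]fgmulUU mulr1.
rewrite /pmon /glaisher (big_morph _ mM (erefl _)); apply: eq_bigr => n _.
by rewrite (big_morph _ mM (erefl _)) prodr_const card_ord.
Qed.

Lemma qraiseX N v k : qraise sg N 0 v -> qraise sg (k * N) 0 (v ^+ k).
Proof.
move=> Nv; elim: k => [|k IHk]; first by rewrite expr0; exact: qraise1.
by rewrite exprS mulSn; exact: (qraiseM (c1 := 0) (c2 := 0)).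
Qed.

Lemma qraise_pmon la : all (leq 1) la -> qraise sg (\sum_(n <- la) n) 0 (pmon la).
Proof.
rewrite pmonE; elim: la => [|n la IHla] /=.
  by rewrite !big_nil => _; exact: qraise1.
move=> /andP[n_gt0 /IHla la_q]; rewrite !big_cons.
apply: (qraiseM (c1 := 0) (c2 := 0)) => //.
rewrite -{1}(partnC 2%N n_gt0); apply/qraiseX/qraise_pvar.
by rewrite odd_part //= odd_double.
Qed.

Lemma coef_pmon_sum (I : finType) (a : I -> K) (F : I -> seq nat) m :
  mcoeff m (\sum_i a i *: pmon (F i)) = \sum_i a i * (glaisher (F i) == m)%:R.
Proof.
pose h (g : Gamma K) : K := mcoeff m g.
have hD : {morph h : x y / x + y} by exact: (@mcoeffD _ K m).
rewrite -[LHS]/(h _) (big_morph h hD (mcoeff0 m)); apply: eq_bigr => i _.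
transitivity (a i * h (pmon (F i))).
  exact: (@mcoeffZ _ K (a i) (pmon (F i)) m).
by rewrite /h mcoeffU.
Qed.

Lemma pmon_free N (a : SP N -> K) :
  \sum_la a la *: pmon la = 0 -> forall la, a la = 0.
Proof.
move=> a0 la; have := coef_pmon_sum a (@parts N) (glaisher la).
rewrite a0 [LHS]mcoeff0 (bigD1 la) //= eqxx mulr1 big1 ?addr0 // => mu ne_mu.
by rewrite (inj_eq (@glaisher_inj N)) (negPf ne_mu) mulr0.
Qed.

(** Spanning gives [A]. A row vector killed by [A] would be a linear relation among distinct
    monomials, so the square matrix [A] is invertible, and [B] is its inverse. *)
Lemma schurQ_basis N : exists A B : 'M[rat]_(#|SP N|),
  [/\ A *m B = 1%:M, B *m A = 1%:M,
      forall i : 'I_#|SP N|, pmon (enum_val i : SP N)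
        = \sum_j map_mx sg A i j *: schurQ K (enum_val j : SP N)
    & forall i : 'I_#|SP N|, schurQ K (enum_val i : SP N)
        = \sum_j map_mx sg B i j *: pmon (enum_val j : SP N)].
Proof.
have /fin_all_exists[f fP] (i : 'I_#|SP N|) : exists f : SP N -> rat,
    pmon (enum_val i : SP N) = \sum_la sg (f la) *: schurQ K la.
  apply: rspan_coord; apply: Qspan_qraise.
  have /and3P[_ la_pos /eqP laN] := valP (enum_val i : SP N).
  by have := qraise_pmon la_pos; rewrite -sumnE laN.
have enum_reindex (F : SP N -> Gamma K) :
    \sum_la F la = \sum_(i < #|SP N|) F (enum_val i).
  by rewrite (reindex _ (onW_bij _ (enum_val_bij _))).
have [A AE] : exists A : 'M[rat]_(#|SP N|), forall i : 'I_#|SP N|,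
    pmon (enum_val i : SP N)
    = \sum_j map_mx sg A i j *: schurQ K (enum_val j : SP N).
  exists (\matrix_(i, j) f i (enum_val j)) => i.
  by rewrite fP enum_reindex; apply: eq_bigr => j _; rewrite !mxE.
have A_unit : A \in unitmx.
  rewrite -row_free_unit; apply: inj_row_free => v vA0; apply/rowP => i.
  rewrite mxE; apply: (fmorph_inj sg); rewrite rmorph0.
  have := @pmon_free N (fun la => map_mx sg v 0 (enum_rank la)).
  rewrite enum_reindex; under eq_bigr do rewrite enum_valK.
  rewrite (lincomb_mulmx _ AE) -map_mxM vA0 big1 => [|k _].
    by move=> /(_ erefl (enum_val i)); rewrite enum_valK mxE.
  by rewrite !mxE rmorph0 scale0r.
exists A, (invmx A).
split; [exact: mulmxV | exact: mulVmx | exact: AE | move=> i].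
by rewrite (lincomb_mulmx _ AE) -map_mxM mulVmx // map_mx1 lincomb_mx1.
Qed.

End Basis.

Section Coordinates.
Variables (K : fieldType) (sg : {rmorphism rat -> K}) (N : nat).

Lemma schurQ_free (a : SP N -> K) :
  \sum_la a la *: schurQ K la = 0 -> forall la, a la = 0.
Proof.
have [A [B [AB BA AE BE]]] := schurQ_basis sg N.
have enum_reindex (F : SP N -> Gamma K) :
    \sum_la F la = \sum_(i < #|SP N|) F (enum_val i).
  by rewrite (reindex _ (onW_bij _ (enum_val_bij _))).
pose w : 'rV[K]_(#|SP N|) := \row_i a (enum_val i).
have wE i : a (enum_val i) = w 0 i by rewrite mxE.
rewrite enum_reindex; under eq_bigr do rewrite wE.
rewrite (lincomb_mulmx _ BE) => wB0.
have {}wB0 : w *m map_mx sg B = 0.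
  apply/rowP => i; rewrite [RHS]mxE.
  have := @pmon_free K N (fun la => (w *m map_mx sg B) 0 (enum_rank la)).
  rewrite enum_reindex; under eq_bigr do rewrite enum_valK.
  by rewrite wB0 => /(_ erefl (enum_val i)); rewrite enum_valK.
move=> la; rewrite -(enum_rankK la) wE.
by rewrite -[w]mulmx1 -(map_mx1 sg) -BA map_mxM mulmxA wB0 mul0mx mxE.
Qed.

(** Linear independence of the Q_lambda leaves only one family of coefficients for [xget] to
    choose. *)
Lemma Qcoef_sum (f : SP N -> K) mu :
  Qcoef (\sum_nu f nu *: schurQ K nu) mu = f mu.
Proof.
rewrite /Qcoef; set P := (X in xget _ X).
suff -> : xget [ffun=> 0] P = finfun f by rewrite ffunE.
apply: xget_unique => [|g E].
  by apply: eq_bigr => nu _; rewrite ffunE.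
apply/ffunP => nu; rewrite ffunE; apply/eqP; rewrite -subr_eq0.
apply/eqP; move: nu; apply: schurQ_free.
under eq_bigr do rewrite scalerBl.
rewrite sumrB; apply/eqP; rewrite subr_eq0; apply/eqP; exact: esym E.
Qed.

End Coordinates.

(** * Diagonal action on power sum monomials *)

Section Pscale.
Variable K : fieldType.
Implicit Types (c : nat -> K) (m : {cmonom nat}).

(** The eigenvalue of [pscale c] on the monomial [m]. *)
Definition weight c m : K := \prod_(i <- finsupp m) c i.*2.+1 ^+ m i.

Lemma monom_pvar m :
  mkmalgU m 1 = \prod_(i <- finsupp m) pvar K i.*2.+1 ^+ m i :> Gamma K.
Proof.
have mM : {morph (fun m : {cmonom nat} => mkmalgU m 1 : Gamma K) :
    x y / mmul x y >-> x * y}.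
  by move=> x y; rewrite [RHS]fgmulUU mulr1.
have cM i : {morph (fun m : {cmonom nat} => m i) : x y / mmul x y >-> (x + y)%N}.
  by move=> x y; exact: cmM.
have {1}-> : m = \big[mmul/mone]_(i <- finsupp m) \big[mmul/mone]_(j < m i) ucm i.
  apply/eqP/cmP => k; rewrite (big_morph _ (cM k) (cm1 k)).
  under eq_bigr => i _.
    rewrite (big_morph _ (cM k) (cm1 k)) sum_nat_const card_ord cmU; over.
  have [k_m|k_m] := boolP (k \in finsupp m).
    rewrite (big_fsetD1 k) //= eqxx muln1 big1_fset ?addn0 // => i.
    by rewrite !inE => /andP[/negPf -> _]; rewrite muln0.
  rewrite big1_fset => [|i i_m _]; first by apply/eqP; rewrite cmE_eq0.
  by case: eqP => [ik|_]; rewrite ?muln0 //; rewrite -ik i_m in k_m.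
rewrite (big_morph _ mM (erefl _)); apply: eq_bigr => i _.
rewrite (big_morph _ mM (erefl _)) prodr_const card_ord.
by rewrite /pvar /= uphalf_double.
Qed.

Lemma pscale_monom c m :
  pscale c (mkmalgU m 1) = weight c m *: (mkmalgU m 1 : Gamma K).
Proof.
rewrite /pscale mmapU /= scale1r mul1r /mon_subst monom_pvar /weight.
rewrite -scaler_prod; apply: eq_bigr => i _.
by rewrite exprZn.
Qed.

Lemma Gamma_monomE (f : Gamma K) :
  f = \sum_(m <- msupp f) mcoeff m f *: (mkmalgU m 1 : Gamma K).
Proof.
rewrite {1}[f]monalgE; apply: eq_bigr => m _; apply/malgP => k.
transitivity (mcoeff m f * mcoeff k (mkmalgU m (1 : K))).
  by rewrite [LHS]mcoeffU [X in _ * X]mcoeffU mulrnAr mulr1.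
exact: esym (@mcoeffZ _ K _ _ k).
Qed.

Lemma pscaleE c (f : Gamma K) :
  pscale c f
  = \sum_(m <- msupp f) (mcoeff m f * weight c m) *: (mkmalgU m 1 : Gamma K).
Proof.
rewrite {1}[f]Gamma_monomE rmorph_sum /=; apply: eq_bigr => m _.
by rewrite pscaleZ pscale_monom scalerA.
Qed.

Lemma pscale_comp c1 c2 c :
  (forall i, c i.*2.+1 = c1 i.*2.+1 * c2 i.*2.+1) ->
  pscale c = pscale c1 \o pscale c2.
Proof.
move=> cE; apply: funext => f /=; rewrite (pscaleE c2) rmorph_sum /= pscaleE.
apply: eq_bigr => m _; rewrite pscaleZ pscale_monom scalerA -mulrA.
suff -> : weight c m = weight c2 m * weight c1 m by [].
by rewrite -big_split; apply: eq_bigr => i _ /=; rewrite -exprMn cE mulrC.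
Qed.

End Pscale.

(** Change of basis to the monomials, where [pscale c] is diagonal. The same [A] and [B] serve for
    every [c]. *)
Lemma Qcoef_pscale (K : fieldType) (sg : {rmorphism rat -> K}) N :
  exists A B : 'M[rat]_(#|SP N|), A *m B = 1%:M /\
  forall (c : nat -> K) (i l : 'I_#|SP N|),
  Qcoef (pscale c (schurQ K (enum_val i : SP N))) (enum_val l : SP N)
  = \sum_j sg (B i j) * weight c (glaisher (enum_val j : SP N)) * sg (A j l).
Proof.
have [A [B [AB BA AE BE]]] := schurQ_basis sg N.
exists A, B; split=> // c i l.
pose D := diag_mx (\row_(j < #|SP N|) weight c (glaisher (enum_val j : SP N))).
pose C := map_mx sg B *m (D *m map_mx sg A).
have DE j : pscale c (pmon K (enum_val j : SP N))
    = \sum_k (D *m map_mx sg A) j k *: schurQ K (enum_val k : SP N).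
  rewrite -(lincomb_mulmx _ AE) (bigD1 j) //= [X in _ + X]big1 => [|k ne_kj].
    by rewrite addr0 !mxE eqxx mulr1n; exact: pscale_monom.
  by rewrite !mxE eq_sym (negPf ne_kj) mulr0n scale0r.
have -> : pscale c (schurQ K (enum_val i : SP N))
    = \sum_la C i (enum_rank la) *: schurQ K (la : SP N).
  rewrite BE [LHS]rmorph_sum [RHS](reindex _ (onW_bij _ (enum_val_bij _))) /=.
  transitivity (\sum_k C i k *: schurQ K (enum_val k : SP N)).
    rewrite -(lincomb_mulmx _ DE).
    by apply: eq_bigr => j _; exact: pscaleZ.
  by apply: eq_bigr => k _; rewrite enum_valK.
rewrite (Qcoef_sum sg) enum_valK mxE; apply: eq_bigr => j _.
by rewrite mul_diag_mx !mxE mulrA.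
Qed.

(** The exponents split into [L] blocks of [M] consecutive ones, each a shift of the first by a
    multiple of [M]. *)
Lemma geom_sum_mul (R : pzRingType) (x : R) M L :
  \sum_(i < M * L) x ^+ i = (\sum_(i < M) x ^+ i) * \sum_(j < L) (x ^+ M) ^+ j.
Proof.
elim: L => [|L IHL]; first by rewrite muln0 !big_ord0 mulr0.
rewrite mulnSr big_split_ord /= IHL big_ord_recr /= mulrDr; congr (_ + _).
by rewrite mulr_suml; apply: eq_bigr => i _; rewrite addnC exprD exprM.
Qed.

Lemma pleth_alphA_mul (K : fieldType) M L (u : K) n :
  pleth_p n (alphA (M * L) u)
  = pleth_p n (alphA M u) * pleth_p n (alphA L (u ^+ M)).
Proof.
have alphAE k (v : K) : pleth_p n (alphA k v) = \sum_(i < k) (v ^+ n) ^+ i.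
  by rewrite pleth_p_alphA; apply: eq_bigr => i _; rewrite mulnC exprM.
by rewrite !alphAE geom_sum_mul -!exprM mulnC.
Qed.

(** * Specialization of rational functions *)

Section FracEval.
Variables (R : idomainType) (F : fieldType) (phi : {rmorphism R -> F}).
Local Notation tofrac := (@FracField.tofrac R).

(** Evaluation is only partially defined, so its compatibility with sums and products is proved for
    this relation first. *)
Definition frac_rep (x : {fraction R}) (y : F) : Prop :=
  exists n d : R, [/\ phi d != 0, x = tofrac n / tofrac d & y = phi n / phi d].

Lemma frac_rep_den d : phi d != 0 -> tofrac d != 0.
Proof.
by apply: contraNneq => /eqP; rewrite tofrac_eq0 => /eqP ->; rewrite rmorph0.
Qed.

(** Cross-multiplying two admissible representatives and applying [phi] shows that the value does
    not depend on the choice. *)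
Lemma frac_evalE x y : frac_rep x y -> frac_eval phi x = y.
Proof.
move=> xy; apply: xget_unique => // _ [n [d [d0 xE ->]]].
case: xy => n' [d' [d'0 xE' ->]]; apply/eqP; rewrite eqr_div // -!rmorphM.
apply/eqP; congr (phi _); apply/eqP.
rewrite -tofrac_eq !rmorphM -eqr_div ?frac_rep_den //.
by rewrite -xE -xE'.
Qed.

Lemma frac_rep_const r : frac_rep (tofrac r) (phi r).
Proof. by exists r, 1; rewrite !rmorph1 !divr1 oner_eq0. Qed.

Lemma frac_rep_div n d :
  phi d != 0 -> frac_rep (tofrac n / tofrac d) (phi n / phi d).
Proof. by exists n, d. Qed.

Lemma frac_repD x1 x2 y1 y2 :
  frac_rep x1 y1 -> frac_rep x2 y2 -> frac_rep (x1 + x2) (y1 + y2).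
Proof.
move=> [n1 [d1 [d10 -> ->]]] [n2 [d2 [d20 -> ->]]].
exists (n1 * d2 + n2 * d1), (d1 * d2).
by rewrite !rmorphD !rmorphM mulf_neq0 // !addf_div // ?frac_rep_den.
Qed.

Lemma frac_repM x1 x2 y1 y2 :
  frac_rep x1 y1 -> frac_rep x2 y2 -> frac_rep (x1 * x2) (y1 * y2).
Proof.
move=> [n1 [d1 [d10 -> ->]]] [n2 [d2 [d20 -> ->]]].
exists (n1 * n2), (d1 * d2).
by rewrite !rmorphM mulf_neq0 // !mulf_div.
Qed.

Lemma frac_rep_sum (I : Type) (r : seq I) (x : I -> {fraction R}) (y : I -> F) :
  (forall i, frac_rep (x i) (y i)) ->
  frac_rep (\sum_(i <- r) x i) (\sum_(i <- r) y i).
Proof.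
move=> xy; apply: big_ind2 => [||//]; last by move=> *; apply: frac_repD.
by rewrite -(rmorph0 tofrac) -(rmorph0 phi); apply: frac_rep_const.
Qed.

Lemma frac_rep_weight (c : nat -> {fraction R}) (c' : nat -> F) m :
  (forall i, frac_rep (c i.*2.+1) (c' i.*2.+1)) ->
  frac_rep (weight c m) (weight c' m).
Proof.
have rep1 : frac_rep 1 1 by have := frac_rep_const 1; rewrite !rmorph1.
move=> cc'; apply: big_ind2 => // [*|i _]; first exact: frac_repM.
elim: (m i) => [|k IHk]; first by rewrite !expr0.
by rewrite !exprS; apply: frac_repM.
Qed.

End FracEval.

Definition rat_Qt : {rmorphism rat -> Qt} := (@FracField.tofrac _ \o polyC).
Definition rat_Qts : {rmorphism rat -> Qts} :=
  (@FracField.tofrac _ \o (polyC \o polyC)).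

Lemma Cts_diagonalization N : exists A B : 'M[rat]_(#|SP N|),
  A *m B = 1%:M /\ forall i l : 'I_#|SP N|,
  Cts (enum_val i) (enum_val l)
  = \sum_j rat_Qts (B i j)
      * weight (fun n => (1 - tQ2 ^+ n) / (1 - sQ2 ^+ n))
          (glaisher (enum_val j : SP N))
      * rat_Qts (A j l).
Proof.
have [A [B [AB CE]]] := Qcoef_pscale rat_Qts N.
by exists A, B; split=> // i l; apply: CE.
Qed.

Lemma one_sub_tQ_neq0 n : (0 < n)%N -> 1 - tQ ^+ n != 0.
Proof.
move=> n_gt0; rewrite -rmorphXn -(rmorph1 (@FracField.tofrac _)) -rmorphB.
rewrite tofrac_eq0 -oppr_eq0 opprB -polyC1; apply: monic_neq0.
exact: monicXnsubC.
Qed.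

(** The rational entries are fixed, and the denominators 1 - s^n become 1 - t^n, which are nonzero
    for odd n. *)
Lemma specialize_ts_weight N M (A B : 'M[rat]_(#|SP N|)) i l :
  specialize_ts M (\sum_j rat_Qts (B i j)
      * weight (fun n => (1 - tQ2 ^+ n) / (1 - sQ2 ^+ n))
          (glaisher (enum_val j : SP N))
      * rat_Qts (A j l))
  = \sum_j rat_Qt (B i j)
      * weight (fun n => (1 - tQ ^+ (M * n)) / (1 - tQ ^+ n))
          (glaisher (enum_val j : SP N))
      * rat_Qt (A j l).
Proof.
pose phi : {rmorphism {poly {poly rat}} -> Qt} :=
  (@FracField.tofrac _ \o horner_eval ('X^M : {poly rat})).
have phiC a : phi a%:P%:P = rat_Qt a by rewrite /phi /= /horner_eval hornerC.
have phit n : phi (1 - 'X ^+ n) = 1 - tQ ^+ (M * n).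
  by rewrite rmorphB rmorph1 rmorphXn /= /horner_eval hornerX -!rmorphXn exprM.
have phis n : phi (1 - ('X)%:P ^+ n) = 1 - tQ ^+ n.
  by rewrite rmorphB rmorph1 rmorphXn /= /horner_eval hornerC.
apply: (@frac_evalE _ _ phi); apply: frac_rep_sum => j.
apply: frac_repM; last by rewrite -phiC; exact: frac_rep_const.
apply: frac_repM; first by rewrite -phiC; exact: frac_rep_const.
apply: frac_rep_weight => k.
have -> : 1 - tQ2 ^+ k.*2.+1 = FracField.tofrac (1 - 'X ^+ k.*2.+1).
  by rewrite rmorphB rmorph1 rmorphXn.
have -> : 1 - sQ2 ^+ k.*2.+1 = FracField.tofrac (1 - ('X)%:P ^+ k.*2.+1).
  by rewrite rmorphB rmorph1 rmorphXn.
by rewrite -phit -phis; apply: frac_rep_div; rewrite phis one_sub_tQ_neq0.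
Qed.

(** Positivity of [M] keeps the new denominators 1 - t^(M n) nonzero. *)
Lemma subst_pow_weight N M L (A B : 'M[rat]_(#|SP N|)) i l : (0 < M)%N ->
  subst_pow M (\sum_j rat_Qt (B i j)
      * weight (fun n => (1 - tQ ^+ (L * n)) / (1 - tQ ^+ n))
          (glaisher (enum_val j : SP N))
      * rat_Qt (A j l))
  = \sum_j rat_Qt (B i j)
      * weight (fun n => (1 - tQ ^+ (M * L * n)) / (1 - tQ ^+ (M * n)))
          (glaisher (enum_val j : SP N))
      * rat_Qt (A j l).
Proof.
move=> M_gt0.
pose phi : {rmorphism {poly rat} -> Qt} :=
  (@FracField.tofrac _ \o comp_poly ('X^M : {poly rat})).
have phiC a : phi a%:P = rat_Qt a by rewrite /phi /= comp_polyC.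
have phit n : phi (1 - 'X ^+ n) = 1 - tQ ^+ (M * n).
  by rewrite rmorphB rmorph1 rmorphXn /= comp_polyX -!rmorphXn exprM.
apply: (@frac_evalE _ _ phi); apply: frac_rep_sum => j.
apply: frac_repM; last by rewrite -[X in frac_rep _ _ X]phiC; exact: frac_rep_const.
apply: frac_repM; first by rewrite -[X in frac_rep _ _ X]phiC; exact: frac_rep_const.
apply: frac_rep_weight => k.
have tE n : 1 - tQ ^+ n = FracField.tofrac (1 - 'X ^+ n).
  by rewrite rmorphB rmorph1 rmorphXn.
rewrite -mulnA -!phit !tE; apply: frac_rep_div.
by rewrite phit one_sub_tQ_neq0 // muln_gt0 M_gt0.
Qed.

(** * Factorization of alphabets, operators and matrices *)

Theorem proposition4p5 (M L : nat) (M_gt0 : (0 < M)%N) (L_gt0 : (0 < L)%N) :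
  [/\ pleth_eq (alphA (M * L) tQ) (alph_mul (alphA M tQ) (alphA L (tQ ^+ M))),
      opT (M * L) tQ = opT L (tQ ^+ M) \o opT M tQ
    & forall N : nat,
        Cmx N (M * L) = Cmx N M *m map_mx (subst_pow M) (Cmx N L)
        /\ Cmx N (M * L) = map_mx (subst_pow M) (Cmx N L) *m Cmx N M].
Proof.
split=> [n _||N].
- by rewrite pleth_pM pleth_alphA_mul.
- by apply: pscale_comp => i; rewrite pleth_alphA_mul mulrC.
have [A [B [AB CtsE]]] := Cts_diagonalization N.
pose A' := map_mx rat_Qt A; pose B' := map_mx rat_Qt B.
have A'B' : A' *m B' = 1%:M by rewrite -map_mxM AB map_mx1.
pose D (c : nat -> Qt) := diag_mx
  (\row_(j < #|SP N|) weight c (glaisher (enum_val j : SP N))).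
have BDA c i l : (B' *m D c *m A') i l
    = \sum_j rat_Qt (B i j) * weight c (glaisher (enum_val j : SP N))
        * rat_Qt (A j l).
  by rewrite mxE; apply: eq_bigr => j _; rewrite mul_mx_diag !mxE.
have CmxE k :
    Cmx N k = B' *m D (fun n => (1 - tQ ^+ (k * n)) / (1 - tQ ^+ n)) *m A'.
  by apply/matrixP => i l; rewrite mxE CtsE specialize_ts_weight BDA.
have CmxL : map_mx (subst_pow M) (Cmx N L)
    = B' *m D (fun n => (1 - tQ ^+ (M * L * n)) / (1 - tQ ^+ (M * n))) *m A'.
  by apply/matrixP => i l; rewrite CmxE // mxE BDA subst_pow_weight // BDA.
(* The inner [A' *m B'] cancels and the weights multiply entrywise. Only the values of [c] at odd
   indices enter them. *)
have mulBDA c1 c2 c : (forall i, c i.*2.+1 = c1 i.*2.+1 * c2 i.*2.+1) ->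
    B' *m D c *m A' = B' *m D c1 *m A' *m (B' *m D c2 *m A').
  move=> cE; rewrite -!mulmxA (mulmxA A' B') A'B' mul1mx (mulmxA (D c1)).
  rewrite mulmx_diag; congr (_ *m (diag_mx _ *m _)); apply/rowP => j; rewrite !mxE.
  by rewrite -big_split; apply: eq_bigr => i _ /=; rewrite cE exprMn.
(* The intermediate factor 1 - t^(M n) cancels; commutativity of these scalars yields both orders of
   the matrix product. *)
have ratioE i : (1 - tQ ^+ (M * L * i.*2.+1)) / (1 - tQ ^+ i.*2.+1)
    = (1 - tQ ^+ (M * L * i.*2.+1)) / (1 - tQ ^+ (M * i.*2.+1))
      * ((1 - tQ ^+ (M * i.*2.+1)) / (1 - tQ ^+ i.*2.+1)).
  by rewrite [RHS]mulrA divfK // one_sub_tQ_neq0 // muln_gt0 M_gt0.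
rewrite CmxL (CmxE M) (CmxE (M * L)%N).
by split; apply: mulBDA => i; rewrite ratioE // mulrC.
Qed.
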